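(* Let $q$ be a prime power, let $m$ and $R$ be positive integers, and let $\xi$ be a generator of $\mathbb{F}_{q^m}$ over $\mathbb{F}_q$. The following are equivalent. (1) $\mu_q^{\mathrm{sym}}(m)\leq R$. (2) There exist $\alpha_1,\ldots,\alpha_R\in\mathbb{F}_{q^m}^{*}$ such that, as $\mathbb{F}_q$-subspaces of $\mathbb{F}_{q^m}^m$, $$\left\langle (1,0,\ldots,0),(\xi,0,\ldots,0),\ldots,(\xi^{m-1},0,\ldots,0)\right\rangle_{\mathbb{F}_q}\subseteq\left\langle(\alpha_1^2,\alpha_1^{1+q},\ldots,\alpha_1^{1+q^{m-1}}),\ldots,(\alpha_R^2,\alpha_R^{1+q},\ldots,\alpha_R^{1+q^{m-1}})\right\rangle_{\mathbb{F}_q}.$$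
   Context: The symmetric tensor rank $\mu_q^{\mathrm{sym}}(m)$ of the multiplication map $M_{q^m}:\mathbb{F}_{q^m}\times\mathbb{F}_{q^m}\to\mathbb{F}_{q^m}$, $(\alpha,\beta)\mapsto\alpha\beta$, is the smallest integer $R$ for which there exist $\mathbb{F}_q$-linear forms $\phi_1,\ldots,\phi_R:\mathbb{F}_{q^m}\to\mathbb{F}_q$ and elements $w_1,\ldots,w_R\in\mathbb{F}_{q^m}$ with $\alpha\beta=\sum_{i=1}^R\phi_i(\alpha)\phi_i(\beta)w_i$ for all $\alpha,\beta\in\mathbb{F}_{q^m}$. A generator of $\mathbb{F}_{q^m}$ over $\mathbb{F}_q$ is an element $\xi$ with $\mathbb{F}_{q^m}=\mathbb{F}_q(\xi)$, so that $1,\xi,\ldots,\xi^{m-1}$ is an $\mathbb{F}_q$-basis of $\mathbb{F}_{q^m}$. $\langle\cdots\rangle_{\mathbb{F}_q}$ denotes $\mathbb{F}_q$-linear span. *)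

(* Defs.v *)
From mathcomp Require Import all_boot all_order all_algebra all_field.
From mathcomp Require Import boolp ring.

Set Implicit Arguments.
Unset Strict Implicit.
Unset Printing Implicit Defensive.

Import GRing.Theory.
Local Open Scope ring_scope.

Definition has_sym_formula (F : fieldType) (L : fieldExtType F) (R : nat) : Prop :=
  exists (phi : 'I_R -> 'Hom(L, F^o)) (w : 'I_R -> L),
    forall a b : L, a * b = \sum_(i < R) (phi i a * phi i b : F) *: w i.

Section Existence.
Variables (F : fieldType) (L : fieldExtType F).

Let ev (s : seq ('Hom(L, F^o) * L)) (a b : L) : L :=
  \sum_(p <- s) (p.1 a * p.1 b : F) *: p.2.

(* Symmetric formulas exist in every characteristic, since
   f(a)g(b) + g(a)f(b) = (f+g)(a)(f+g)(b) - f(a)f(b) - g(a)g(b). *)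
Lemma has_sym_formula_ex : exists R, `[< has_sym_formula L R >].
Proof.
have cross (f : 'Hom(L, F^o)) x (s : seq ('Hom(L, F^o) * L)) : exists t, forall a b,
    \sum_(p <- s) (f a * p.1 b + p.1 a * f b : F) *: (x * p.2) = ev t a b.
  elim: s => [|[g y] s [t IHt]].
    by exists [::] => a b; rewrite /ev !big_nil.
  exists [:: (f + g, x * y), (f, - (x * y)), (g, - (x * y)) & t] => a b.
  rewrite /ev !big_cons IHt /= !add_lfunE !scalerN -!scaleNr !addrA -!scalerDl.
  congr (_ *: _ + _).
  have polar (u v u' v' : F) :
    u * v' + v * u' = (u + v) * (u' + v') - u * u' - v * v' by ring.
  exact: polar.
have prodP (s : seq ('Hom(L, F^o) * L)) : exists t, forall a b,
    (\sum_(p <- s) (p.1 a : F) *: p.2) * (\sum_(p <- s) (p.1 b : F) *: p.2)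
    = ev t a b.
  elim: s => [|[f x] s [t IHt]].
    by exists [::] => a b; rewrite /ev !big_nil mul0r.
  have [t' Ht'] := cross f x s.
  exists ((f, x * x) :: t' ++ t) => a b.
  rewrite /ev !big_cons big_cat /= -/(ev t' a b) -/(ev t a b) -Ht' -IHt.
  rewrite mulrDl !mulrDr -scalerAl -scalerAr scalerA -!addrA; congr (_ + _).
  rewrite addrA; congr (_ + _).
  rewrite mulr_sumr mulr_suml -big_split /=; apply: eq_bigr => p _.
  rewrite scalerDl -!scalerAl -!scalerAr !scalerA [p.2 * x]mulrC.
  by congr (_ + _).
pose X := vbasis {:L}.
have [t Ht] := prodP [seq (linfun (coord X i : L -> F^o), X`_i) | i : 'I_(\dim {:L})].
have dec a : \sum_(p <- [seq (linfun (coord X i : L -> F^o), X`_i) | i : 'I_(\dim {:L})])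
    (p.1 a : F) *: p.2 = a.
  rewrite big_image /= [RHS](coord_vbasis (memvf a)).
  by apply: eq_bigr => i _; rewrite lfunE.
exists (size t); apply/asboolP.
exists (fun i => (tnth (in_tuple t) i).1), (fun i => (tnth (in_tuple t) i).2) => a b.
by rewrite -{1}(dec a) -{1}(dec b) Ht /ev big_tnth.
Qed.

End Existence.

Definition mu_sym (F : fieldType) (L : fieldExtType F) : nat :=
  ex_minn (has_sym_formula_ex L).

(* Main.v *)
From HB Require Import structures.
Require Import Defs.
From mathcomp Require Import all_boot all_order all_algebra all_field.
From mathcomp Require Import boolp.

Set Implicit Arguments.
Unset Strict Implicit.
Unset Printing Implicit Defensive.

Import GRing.Theory.
Local Open Scope ring_scope.

(** Every linear form on L is a |-> Tr (alpha a) for a unique alpha, so a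
symmetric formula is an identity
  a b = \sum_i Tr (alpha_i a) Tr (alpha_i b) w_i,
and a summand whose form vanishes may be replaced by one with alpha_i != 0 and
w_i = 0 ([mu_sym_le_trace]).

Testing this identity against the forms Tr (c _), it holds if and only if, for
every c, with the scalars l_i = Tr (c w_i),
  Tr (c a b) = \sum_i l_i Tr (alpha_i a) Tr (alpha_i b)    for all a, b.
Nondegeneracy of the trace in b turns this into
  c a = \sum_i l_i Tr (alpha_i a) alpha_i
      = \sum_(j < m) (\sum_i l_i alpha_i ^ (1 + q^j)) a ^ (q^j)    for all a.
Both sides are q-polynomials in a of degree less than q^m = #|L|, so they agree
exactly when their coefficients do: the vectors (alpha_i ^ (1 + q^j))_j,
weighted by the l_i, add up to (c, 0, ..., 0) ([quad_vec_combP]).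

A symmetric formula with coefficients alpha_i thus makes every (c, 0, ..., 0)
lie in the span of these vectors. Conversely, if they all do, the l_i can be
chosen to depend linearly on c, hence to be of the form Tr (c w_i), which gives
the formula back ([trace_formulaP]). Since the powers of xi span L, it is enough
to ask this for c = xi^s with s < m ([first_coord_vec_spanP]). *)

(** * The trace form of a finite field extension *)

Section FiniteFieldTrace.

Variables (F : finFieldType) (L : fieldExtType F).
Local Notation q := #|F|.
Local Notation m := (\dim {:L}).

Lemma pchar_pnat_card_exp j : [pchar L].-nat (q ^ j)%N.
Proof.
have [p p_pr pF] := finPcharP F.
have pL : p \in [pchar L] by rewrite pchar_lalg.
rewrite (eq_pnat _ (pcharf_eq pL)) pnatX (card_pprimeChar pF) pnatX pnat_id //.
Qed.

(** A q-polynomial with m terms has degree at most q^(m-1), too small for all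
the q^m elements of L to be roots unless it is zero. *)
Lemma linearized_eq0 (c : 'I_m -> L) :
  (forall a, \sum_j c j * a ^+ (q ^ j) = 0) -> forall j, c j = 0.
Proof.
move=> c_vanish j.
have q_gt1 : (1 < q)%N by apply: finNzRing_gt1.
pose p : {poly L} := \sum_i c i *: 'X^(q ^ i).
have coef_p : p`_(q ^ j) = c j.
  rewrite coef_sum (bigD1 j) //= coefZ coefXn eqxx mulr1 big1 ?addr0 // => i ne_ij.
  rewrite coefZ coefXn; case: eqP => [/eqP|_]; last by rewrite mulr0.
  by rewrite eqn_exp2l // => /eqP/val_inj eq_ji; rewrite eq_ji eqxx in ne_ij.
suff p0 : p = 0 by rewrite -coef_p p0 coef0.
apply/eqP; apply: contraT => p_neq0.
have size_p : (size p <= q ^ m)%N.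
  rewrite (leq_trans (size_sum _ _ _)) //; apply/bigmax_leqP => i _.
  rewrite (leq_trans (size_scale_leq _ _)) // size_polyXn.
  by rewrite ltn_exp2l.
have card_L : #|finvect_type L| = (q ^ m)%N.
  by rewrite -(card_vspacef (Vector.class (finvect_type L))) card_vspace.
suff : (#|finvect_type L| < size p)%N by rewrite card_L ltnNge size_p.
rewrite cardT; apply: (max_poly_roots p_neq0); last exact: enum_uniq.
apply/allP => a _; rewrite rootE horner_sum.
under eq_bigr => i _ do rewrite hornerZ hornerXn.
by rewrite c_vanish.
Qed.

(** The trace of L over F with values in L; [tr] below lowers it to F. *)
Definition frob_sum (x : L) : L := \sum_(j < m) x ^+ (q ^ j).

Lemma frob_sum_is_semilinear : semilinear frob_sum.
Proof.
split=> [a x | x y].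
  rewrite /frob_sum scaler_sumr; apply: eq_bigr => j _.
  rewrite exprZn; congr (_ *: _); elim: (j : nat) => [|n IHn] //.
  by rewrite expnS exprM expf_card.
rewrite /frob_sum -big_split; apply: eq_bigr => j _.
by rewrite exprDn_pchar // pchar_pnat_card_exp.
Qed.

(** Raising to the power q permutes the conjugates cyclically, since
x ^ (q^m) = x; and F consists of the fixed points of that map. *)
Lemma frob_sum_in1 x : frob_sum x \in 1%VS.
Proof.
rewrite (Fermat's_little_theorem 1%AS) dimv1 expn1; apply/eqP.
have -> : frob_sum x ^+ q = \sum_(j < m) x ^+ (q ^ j.+1).
  rewrite /frob_sum -(big_mkord xpredT (fun j => x ^+ (q ^ j))).
  rewrite -(big_mkord xpredT (fun j => x ^+ (q ^ j.+1))).
  elim/big_rec2: _ => [|j y1 y2 _ <-].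
    by rewrite expr0n gtn_eqF // ltnW // finNzRing_gt1.
  rewrite exprDn_pchar -?exprM -?expnSr //.
  by have := pchar_pnat_card_exp 1; rewrite expn1.
rewrite /frob_sum; have : (0 < m)%N by rewrite adim_gt0.
have : x ^+ (q ^ m) = x.
  by apply/eqP; rewrite -(Fermat's_little_theorem {:L}%AS) memvf.
case: m => // n xq _; rewrite big_ord_recr big_ord_recl /= xq expn0 expr1 addrC.
by congr (_ + _); apply: eq_bigr => j _.
Qed.

Definition tr (x : L) : F := coord [tuple (1%R : L)] ord0 (frob_sum x).

Lemma trE x : (tr x)%:A = frob_sum x.
Proof.
have x1 : frob_sum x \in <<[tuple (1%R : L)]>>%VS by rewrite span_seq1 frob_sum_in1.
by rewrite [RHS](coord_span x1) big_ord1.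
Qed.

Lemma tr_is_semilinear : semilinear (tr : L -> F^o).
Proof.
have [fZ fD] := frob_sum_is_semilinear.
by split=> [a x|x y]; rewrite /tr ?fZ ?fD (linearZ, linearD).
Qed.
HB.instance Definition _ := GRing.isSemilinear.Build F L F^o _ tr tr_is_semilinear.

(** As a function of a, Tr (x a) is the q-polynomial with coefficients x ^ (q^j),
the first of which is x itself. *)
Lemma tr_nondegenerate x : (forall a, tr (x * a) = 0) -> x = 0.
Proof.
move=> tr0; have m_gt0 : (0 < m)%N by rewrite adim_gt0.
rewrite -[x]expr1 -(expn0 q).
apply: (linearized_eq0 (c := fun j : 'I_m => x ^+ (q ^ j))) (Ordinal m_gt0) => a.
under eq_bigr => j _ do rewrite -exprMn.
by rewrite -/(frob_sum _) -trE tr0 scale0r.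
Qed.

Definition tr_form (x : L) : 'Hom(L, F^o) :=
  (linfun (tr : L -> F^o) \o amull x)%VF.

Lemma tr_formE x a : tr_form x a = tr (x * a).
Proof. by rewrite comp_lfunE lfunE lfunE. Qed.

Lemma tr_form_is_semilinear : semilinear tr_form.
Proof.
split=> [k x|x y]; rewrite /tr_form.
  by rewrite linearZ /= comp_lfunZr.
by rewrite linearD /= comp_lfunDr.
Qed.
HB.instance Definition _ :=
  GRing.isSemilinear.Build F L 'Hom(L, F^o) _ tr_form tr_form_is_semilinear.

(** By nondegeneracy x |-> Tr (x _) is injective, and L and its dual have the
same dimension. *)
Lemma tr_form_surj (f : 'Hom(L, F^o)) : exists x, tr_form x = f.
Proof.
have inj : lker (linfun tr_form) == 0%VS.
  rewrite -subv0; apply/subvP => x; rewrite memv_ker memv0 lfunE /= => /eqP x0.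
  by apply/eqP/tr_nondegenerate => a; rewrite -tr_formE x0 lfunE.
have : f \in limg (linfun tr_form).
  suff -> : limg (linfun tr_form) = fullv by rewrite memvf.
  apply/eqP; rewrite eqEdim subvf limg_dim_eq ?(eqP inj) ?capv0 // !dimvf.
  by rewrite /dim /= muln1.
by case/memv_imgP => x _ ->; exists x; rewrite lfunE.
Qed.

(** * Symmetric formulas and spans of quadratic vectors *)

Definition first_coord_vec (c : L) : {ffun 'I_m -> L} :=
  [ffun j : 'I_m => if j == 0%N :> nat then c else 0].

Definition quad_vec (a : L) : {ffun 'I_m -> L} :=
  [ffun j : 'I_m => a ^+ (1 + q ^ j)].

Lemma first_coord_vec_is_semilinear : semilinear first_coord_vec.
Proof.
split=> [k x|x y]; apply/ffunP => j; rewrite !ffunE; case: ifP => _ //.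
  by rewrite scaler0.
by rewrite addr0.
Qed.
HB.instance Definition _ := GRing.isSemilinear.Build F L {ffun 'I_m -> L} _
  first_coord_vec first_coord_vec_is_semilinear.

(** The coordinates of the difference between the two sides of the vector
equation are the coefficients of a q-polynomial D in a, and Tr (D(a) b) is the
difference between the two bilinear forms. The uniqueness of the coefficients of
D and the nondegeneracy of the trace make these vanish together. *)
Lemma quad_vec_combP n (alpha : 'I_n -> L) (l : 'I_n -> F) (c : L) :
  \sum_i l i *: quad_vec (alpha i) = first_coord_vec c <->
  forall a b, tr (c * (a * b)) =
    \sum_i l i * (tr (alpha i * a) * tr (alpha i * b)).
Proof.
pose d (j : 'I_m) : L := (\sum_i l i *: quad_vec (alpha i) - first_coord_vec c) j.
have dE a : \sum_j d j * a ^+ (q ^ j) =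
    \sum_i (l i * tr (alpha i * a)) *: alpha i - c * a.
  under eq_bigr => j _ do rewrite /d !ffunE sum_ffunE mulrBl.
  rewrite sumrB; congr (_ - _).
    under eq_bigr => j _ do rewrite mulr_suml.
    rewrite exchange_big /=; apply: eq_bigr => i _.
    rewrite -scalerA -[tr _ *: _]mulr_algl trE mulr_suml scaler_sumr.
    apply: eq_bigr => j _.
    by rewrite !ffunE -scalerAl exprS exprMn [alpha i * _]mulrC mulrAC.
  have m_gt0 : (0 < m)%N by rewrite adim_gt0.
  rewrite (bigD1 (Ordinal m_gt0)) //= expn0 expr1 big1 ?addr0 // => j.
  by rewrite -val_eqE /= => /negPf->; rewrite mul0r.
have form_dE a b : tr ((\sum_j d j * a ^+ (q ^ j)) * b) =
    \sum_i l i * (tr (alpha i * a) * tr (alpha i * b)) - tr (c * (a * b)).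
  rewrite dE mulrBl linearB /= mulrA mulr_suml linear_sum; congr (_ - _).
  by apply: eq_bigr => i _; rewrite -scalerAl linearZ [RHS]mulrA.
split=> [comb a b | forms].
  apply/esym/eqP; rewrite -subr_eq0 -form_dE big1 ?mul0r ?linear0 // => j _.
  by rewrite /d comb subrr ffunE mul0r.
apply/ffunP => j; apply/eqP; rewrite -subr_eq0; apply/eqP.
suff : d j = 0 by rewrite /d !ffunE.
apply: linearized_eq0 j => a; apply: tr_nondegenerate => b.
by rewrite form_dE forms subrr.
Qed.

(** Passing from the formula to the span takes the scalars Tr (c w_i). For the
converse, one needs scalars that are linear in c even if the quadratic vectors
are dependent: [coord] provides them, and the w_i come from the surjectivity of
[tr_form]. *)
Lemma trace_formulaP n (alpha : 'I_n -> L) :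
  (exists w : 'I_n -> L,
     forall a b, a * b = \sum_i (tr (alpha i * a) * tr (alpha i * b)) *: w i) <->
  (forall c, first_coord_vec c \in <<[seq quad_vec (alpha i) | i : 'I_n]>>%VS).
Proof.
split=> [[w formula] c | in_span].
  have /quad_vec_combP <- : forall a b, tr (c * (a * b)) =
      \sum_i tr (c * w i) * (tr (alpha i * a) * tr (alpha i * b)).
    move=> a b; rewrite (formula a b) mulr_sumr linear_sum; apply: eq_bigr => i _.
    by rewrite -scalerAr linearZ [RHS]mulrC.
  by apply: memv_suml => i _; rewrite memvZ // memv_span // image_f.
pose X := [tuple quad_vec (alpha i) | i < n].
have coordE c : \sum_i coord X i (first_coord_vec c) *: quad_vec (alpha i)
    = first_coord_vec c.
  rewrite [RHS](@coord_span _ _ _ X) ?in_span //.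
  by apply: eq_bigr => i _; rewrite -tnth_nth tnth_mktuple.
have rep i : exists w, forall c, tr (w * c) = coord X i (first_coord_vec c).
  have [w wE] := tr_form_surj (linfun (coord X i \o first_coord_vec : L -> F^o)).
  by exists w => c; rewrite -tr_formE wE lfunE.
have [w wE] := fin_all_exists rep; exists w => a b.
apply/eqP; rewrite -subr_eq0; apply/eqP/tr_nondegenerate => c.
rewrite mulrBl linearB /= mulrC.
have /quad_vec_combP -> := coordE c.
apply/eqP; rewrite subr_eq0 mulr_suml linear_sum; apply/eqP/eq_bigr => i _.
by rewrite -scalerAl linearZ /= wE [RHS]mulrC.
Qed.

Lemma first_coord_vec_spanP (xi : L) (V : {vspace {ffun 'I_m -> L}}) :
    <<1; xi>>%VS = {:L}%VS ->
  (<<[seq first_coord_vec (xi ^+ s) | s : 'I_m]>> <= V)%VS <->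
  (forall c, first_coord_vec c \in V).
Proof.
move=> xi_gen; split=> [/subvP sub c | sub]; last first.
  by apply/span_subvP => _ /imageP[s _ ->].
have deg : adjoin_degree 1 xi = m.
  by rewrite -[RHS](congr1 (fun U : {vspace L} => \dim U) xi_gen) dim_Fadjoin dimv1 muln1.
have c_gen : c \in <<1; xi>>%VS by rewrite xi_gen memvf.
have size_p : (size (Fadjoin_poly 1 xi c) <= m)%N by rewrite -deg size_Fadjoin_poly.
rewrite -(Fadjoin_poly_eq c_gen) (horner_coef_wide _ size_p) linear_sum memv_suml // => s _.
have /polyOverP/(_ s)/vlineP[k ->] := Fadjoin_polyOver 1 xi c.
rewrite -scalerAl mul1r linearZ memvZ // sub // memv_span //.
by apply/imageP; exists s.
Qed.

End FiniteFieldTrace.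


(** A formula of minimal length is padded to length R; the padding and the
summands whose form is zero become alpha_i = 1, w_i = 0. *)
Lemma mu_sym_le_trace (F : finFieldType) (L : fieldExtType F) (R : nat) :
  (mu_sym L <= R)%N <->
  exists alpha : 'I_R -> L, (forall i, alpha i != 0) /\
    exists w : 'I_R -> L,
     forall a b, a * b = \sum_i (tr (alpha i * a) * tr (alpha i * b)) *: w i.
Proof.
rewrite /mu_sym; case: ex_minnP => n /asboolP[phi [w formula]] n_min; split; last first.
  move=> [alpha [_ [v]]] formula'; apply: n_min; apply/asboolP.
  exists (fun i => tr_form (alpha i)), v => a b; rewrite formula'.
  by apply: eq_bigr => i _; rewrite !tr_formE.
move=> le_nR.
(* Indexing the summands by nat extends the formula by zero beyond n. *)
pose term (a b : L) (k : nat) : L :=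
  if insub k is Some i then (phi i a * phi i b : F) *: w i else 0.
have traceE (k : 'I_R) : exists av : L * L, av.1 != 0 /\
    forall a b, term a b k = (tr (av.1 * a) * tr (av.1 * b)) *: av.2.
  rewrite /term; case: insubP => [i _ _|_]; last first.
    by exists (1, 0); rewrite oner_neq0; split=> // a b; rewrite scaler0.
  have [x xE] := tr_form_surj (phi i); have [x0|x_neq0] := eqVneq x 0.
    exists (1, 0); rewrite oner_neq0; split=> // a b.
    by rewrite -xE x0 linear0 zero_lfunE mul0r scale0r scaler0.
  by exists (x, w i); split=> // a b; rewrite -xE !tr_formE.
have [av avP] := fin_all_exists traceE.
exists (fun i => (av i).1); split=> [i|]; first by case: (avP i).
exists (fun i => (av i).2) => a b.
have -> : a * b = \sum_(k < n) term a b k.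
  by rewrite formula; apply: eq_bigr => i _; rewrite /term valK.
rewrite (big_ord_widen _ (term a b) le_nR) big_mkcond.
apply: eq_bigr => k _; rewrite -(avP k).2; case: ltnP => // le_nk.
by rewrite /term insubN // -leqNgt.
Qed.

Theorem proposition3p1 (F : finFieldType) (L : fieldExtType F) (q m R : nat)
    (card_F : #|F| = q) (dim_L : \dim {:L} = m) (m_gt0 : (0 < m)%N)
    (R_gt0 : (0 < R)%N) (xi : L) (xi_gen : <<1; xi>>%VS = {:L}%VS) :
  (mu_sym L <= R)%N <->
  exists alpha : 'I_R -> L,
    (forall i, alpha i != 0) /\
    (<<[seq [ffun j : 'I_m => (if j == 0%N :> nat then xi ^+ s else 0)%R]
         | s : 'I_m]>>
     <= <<[seq [ffun j : 'I_m => (alpha i ^+ (1 + q ^ j))%R] | i : 'I_R]>>)%VS.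
Proof.
subst q m; rewrite mu_sym_le_trace.
split=> -[alpha [alpha_neq0 H]]; exists alpha; split=> //.
  by apply/(first_coord_vec_spanP _ xi_gen)/trace_formulaP.
by apply/trace_formulaP/(first_coord_vec_spanP _ xi_gen).
Qed.
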